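(* Let $\mu\in(0,1)$, $\epsilon\in(0,1)$ and $\rho\in(0,1)$, let $V(N,\rho)$ be the value function of the malicious expert against the multiplicative weights algorithm with parameter $\epsilon$, with horizon $N$ and initial weight $\rho$ of the malicious expert (as defined in the context), and let $g(\rho)=\frac{1}{1+(1/\rho-1)/\epsilon}$. Then $$\liminf_{N\to\infty}\frac{V(N,\rho)}{N}\ \ge\ 1-\mu+\mu(1-\mu)\big(\rho-g(\rho)\big)\ >\ 1-\mu .$$
   Context: Prediction game. There are two experts and a forecaster. At each round $t=1,2,\dots$ the true outcome is $y_t\in\{0,1\}$, expert $i\in\{1,2\}$ predicts $x_t^i\in\{0,1\}$, and expert $i$ has weight $p_t^i\ge 0$ with $p_t^1+p_t^2=1$. The forecaster predicts $\hat y_t=p_t^1x_t^1+p_t^2x_t^2$ and suffers the loss $l(\hat y_t,y_t)=|\hat y_t-y_t|$. The multiplicative weights algorithm with parameter $\epsilon\in(0,1)$ updates $$p_{t+1}^i=\frac{p_t^i\,\epsilon^{|x_t^i-y_t|}}{p_t^1\epsilon^{|x_t^1-y_t|}+p_t^2\epsilon^{|x_t^2-y_t|}},\quad i=1,2.$$ Let $\mathcal G_t=\{p_l^1,p_l^2,x_l^1,x_l^2,y_l: l=1,\dots,t-1\}\cup\{p_t^1,p_t^2\}$ be the history before round $t$. Expert 2 is honest: at each round, independently of $\mathcal G_t$ (and of expert 1's choice at that round), $x_t^2=y_t$ with probability $\mu$ and $x_t^2=1-y_t$ with probability $1-\mu$. Expert 1 is malicious: at each round he chooses, as a function $\alpha_t$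 of $\mathcal G_t$, an action in $\{T,L\}$, where $T$ (truth) means $x_t^1=y_t$ and $L$ (lie) means $x_t^1=1-y_t$. A strategy is a sequence $\alpha=(\alpha_1,\alpha_2,\dots)$ of such functions. Consequently the loss at round $t$ is $p_t^1$ if $\alpha_t=L,\ x_t^2=y_t$; $1$ if $\alpha_t=L,\ x_t^2=1-y_t$; $0$ if $\alpha_t=T,\ x_t^2=y_t$; and $1-p_t^1$ if $\alpha_t=T,\ x_t^2=1-y_t$. The weight evolves by $p_{t+1}^1=g(p_t^1)$ if $\alpha_t=L,\ x_t^2=y_t$; $p_{t+1}^1=g^{(-1)}(p_t^1)$ if $\alpha_t=T,\ x_t^2=1-y_t$; and $p_{t+1}^1=p_t^1$ otherwise, where $$g(p)=\frac{1}{1+(1/p-1)/\epsilon},\qquad g^{(-1)}(p)=\frac{1}{1+(1/p-1)\epsilon}.$$ The value function is $$V(N,\rho)=\max_{\alpha}\mathbb E^{\alpha}\Big[\sum_{t=1}^N l(\hat y_t,y_t)\,\Big|\,p_1^1=\rho\Big],$$ the maximum being over all strategies $\alpha$ of the malicious expert. *)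

(* Defs.v *)
From mathcomp Require Import all_boot all_order all_algebra.
From mathcomp Require Import all_classical all_reals all_analysis.
Set Implicit Arguments.
Unset Strict Implicit.
Unset Printing Implicit Defensive.
Import Order.TTheory GRing.Theory Num.Theory.
Import numFieldNormedType.Exports.
Local Open Scope classical_set_scope.
Local Open Scope ring_scope.

(* Outcomes and expert predictions in {0,1} are booleans, so b%:R is their
   numerical value and |a - b| is (a != b). Rounds are numbered from 0. *)

Inductive action := Truth | Lie.

Record round (R : realType) := Round {
  rd_p1 : R; rd_p2 : R; rd_x1 : bool; rd_x2 : bool; rd_y : bool }.

(* The history before a round: the past rounds, oldest first, together with
   the current weights (p^1, p^2). *)
Definition history (R : realType) := (seq (round R) * (R * R))%type.

Definition strategy (R : realType) := nat -> history R -> action.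

Definition malicious_prediction (a : action) (y : bool) : bool :=
  if a is Truth then y else ~~ y.

Section Game.
Context {R : realType}.
Variables (eps rho : R).

Definition mw_update (p : R * R) (x1 x2 y : bool) : R * R :=
  let w1 := p.1 * eps ^+ (x1 != y) in
  let w2 := p.2 * eps ^+ (x2 != y) in
  (w1 / (w1 + w2), w2 / (w1 + w2)).

Definition forecast (p : R * R) (x1 x2 : bool) : R :=
  p.1 * x1%:R + p.2 * x2%:R.

Section Play.
Variables (alpha : strategy R) (y x2 : nat -> bool).

Fixpoint hist (t : nat) : history R :=
  if t is s.+1 then
    let h := hist s in
    let x1 := malicious_prediction (alpha s h) (y s) in
    (rcons h.1 (Round h.2.1 h.2.2 x1 (x2 s) (y s)),
     mw_update h.2 x1 (x2 s) (y s))
  else ([::], (rho, 1 - rho)).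

Definition loss (t : nat) : R :=
  let h := hist t in
  let x1 := malicious_prediction (alpha t h) (y t) in
  `| forecast h.2 x1 (x2 t) - (y t)%:R |.

End Play.

Section RandomPlay.
Context d (T : measurableType d) (P : probability T R).
Variables (y x2 : nat -> {RV P >-> bool}).

(* Expert 2 is correct with probability mu, independently of the history G_t,
   whatever the strategy of expert 1. The action of expert 1 is a function of
   G_t, so the independence covers it as well; S := setT gives the marginal
   probability mu. Each history takes finitely many values and depends
   measurably on the sample point, so every set S of histories is allowed. *)
Definition honest (mu : R) : Prop :=
  forall (alpha : strategy R) (t : nat) (S : set (history R)),
    P [set w | S (hist alpha (y^~ w) (x2^~ w) t) /\ x2 t w = y t w] =
    (P [set w | S (hist alpha (y^~ w) (x2^~ w) t)] * mu%:E)%E.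

Definition expected_loss (alpha : strategy R) (N : nat) : \bar R :=
  'E_P[fun w => \sum_(t < N) loss alpha (y^~ w) (x2^~ w) t].

(* The supremum is a maximum, see value_attained. *)
Definition value (N : nat) : \bar R :=
  ereal_sup [set expected_loss alpha N | alpha in [set: strategy R]].

End RandomPlay.
End Game.

Definition g {R : realType} (eps p : R) : R := 1 / (1 + (1 / p - 1) / eps).

Section Attained.
Context {R : realType} (eps rho : R).
Context d (T : measurableType d) (P : probability T R).
Variables (y x2 : nat -> {RV P >-> bool}).

Lemma eq_hist (alpha : strategy R) (y1 z1 y2 z2 : nat -> bool) (t : nat) :
  (forall s, (s < t)%N -> y1 s = y2 s) -> (forall s, (s < t)%N -> z1 s = z2 s) ->
  hist eps rho alpha y1 z1 t = hist eps rho alpha y2 z2 t.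
Proof.
elim: t => [//|t IH] hy hz /=.
rewrite IH ?hy ?hz //.
- by move=> s st; apply: hy; exact: ltnW.
- by move=> s st; apply: hz; exact: ltnW.
Qed.

Let is_lie (a : action) := if a is Lie then true else false.

Let is_lie_inj : injective is_lie. Proof. by case; case. Qed.

Let behaviour (N : nat) (alpha : strategy R) :
    {ffun 'I_N * (N.-tuple bool * N.-tuple bool) -> bool} :=
  [ffun u : 'I_N * (N.-tuple bool * N.-tuple bool) => is_lie (alpha u.1
     (hist eps rho alpha (nth false u.2.1) (nth false u.2.2) u.1))].

Let behaviour_action N (alpha : strategy R) (t : 'I_N) (a b : nat -> bool) :
  is_lie (alpha t (hist eps rho alpha a b t)) =
  behaviour N alpha (t, ([tuple a i | i < N], [tuple b i | i < N])).
Proof.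
rewrite ffunE; congr (is_lie (alpha _ _)); apply: eq_hist => s st /=;
  have sN := ltn_trans st (ltn_ord t).
- by have := tnth_mktuple (fun i : 'I_N => a i) (Ordinal sN); rewrite (tnth_nth false).
- by have := tnth_mktuple (fun i : 'I_N => b i) (Ordinal sN); rewrite (tnth_nth false).
Qed.

Let behaviour_eq N (alpha beta : strategy R) : behaviour N alpha = behaviour N beta ->
  expected_loss eps rho y x2 alpha N = expected_loss eps rho y x2 beta N.
Proof.
move=> e; rewrite /expected_loss; congr expectation; apply/funext => w.
have ea (t : 'I_N) : alpha t (hist eps rho alpha (y^~ w) (x2^~ w) t) =
    beta t (hist eps rho beta (y^~ w) (x2^~ w) t).
  by apply: is_lie_inj; rewrite !behaviour_action e.
have eh t : (t <= N)%N -> hist eps rho alpha (y^~ w) (x2^~ w) t =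
    hist eps rho beta (y^~ w) (x2^~ w) t.
  elim: t => [//|t IH] tN /=.
  by have /= -> := ea (Ordinal tN); rewrite IH // ltnW.
apply: eq_bigr => t _; rewrite /loss ea eh //; exact: ltnW.
Qed.

Lemma value_attained (N : nat) : exists alpha : strategy R,
  value eps rho y x2 N = expected_loss eps rho y x2 alpha N.
Proof.
pose a0 : strategy R := fun _ _ => Truth.
pose pick b : strategy R :=
  if pselect (exists a, behaviour N a = b) is left h then sval (cid h) else a0.
have pickE a : expected_loss eps rho y x2 (pick (behaviour N a)) N =
    expected_loss eps rho y x2 a N.
  apply: behaviour_eq; rewrite /pick; case: pselect => [h|[]]; last by exists a.
  exact: (svalP (cid h)).
pose F b := expected_loss eps rho y x2 (pick b) N.
pose b0 := behaviour N a0.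
have [b _ bmax] := @Order.TotalTheory.arg_maxP _ _ _ b0 xpredT F isT.
exists (pick b); apply/eqP; rewrite eq_le; apply/andP; split.
- by apply: ge_ereal_sup => _ [a _ <-]; rewrite -pickE; exact: bmax.
- by apply: ereal_sup_ubound; exists (pick b).
Qed.

End Attained.

(* Main.v *)
(* The malicious expert lies while his weight is rho and tells the truth while
   it is g rho. A lie moves the weight to g rho exactly when expert 2 is correct,
   and a truth moves it back to rho exactly when expert 2 is wrong; so from the
   second round on, the weight is rho exactly when expert 2 was wrong in the
   previous round, which has probability 1 - mu. The expected loss of each such
   round is then (1 - mu) (1 - mu + mu rho) + mu (1 - mu) (1 - g rho), which is
   the claimed bound, and the first round only does better. Hence the bound on
   V(N, rho) / N already holds for every N > 0. *)

Require Import Defs.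
From mathcomp Require Import all_boot all_order all_algebra.
From mathcomp Require Import all_classical all_reals all_analysis.
From mathcomp Require Import measurable_realfun ring lra.
Import Order.TTheory GRing.Theory Num.Theory.
Import numFieldNormedType.Exports.
Local Open Scope classical_set_scope.
Local Open Scope ring_scope.

(** * Weights and losses along a play of [toggle] *)

Definition toggle {R : realType} (rho : R) : strategy R :=
  fun _ h => if h.2 == (rho, 1 - rho) then Lie else Truth.

(** It refers only to the previous round's outcome and expert 2's prediction, so its probability is
    available without the weights; [hist_toggle] identifies it with the weight being [rho]. *)
Definition at_start (y x2 : nat -> bool) (t : nat) : bool :=
  if t is s.+1 then x2 s != y s else true.

Section Toggle.
Context {R : realType} (eps rho : R).
Context (eps01 : 0 < eps < 1) (rho01 : 0 < rho < 1).

Lemma mw_weight_gt0 : 0 < rho * eps + (1 - rho).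
Proof.
by move/andP: rho01 eps01 => [? ?] /andP[? _]; rewrite addr_gt0 ?subr_gt0 ?mulr_gt0.
Qed.

(** This is the form in which [mw_update] produces the weight from [(rho, 1 - rho)] after a lie with
    expert 2 correct. *)
Lemma gE : g eps rho = rho * eps / (rho * eps + (1 - rho)).
Proof.
have h := lt0r_neq0 mw_weight_gt0.
move/andP: rho01 eps01 => [r0 r1] /andP[e0 e1].
rewrite /g; field; rewrite !(lt0r_neq0 e0) !(lt0r_neq0 r0) /= ?andbT.
by apply: contra_neq h => <-; ring.
Qed.

Lemma g_gt0 : 0 < g eps rho.
Proof.
rewrite gE; move/andP: rho01 eps01 => [? ?] /andP[? _].
by rewrite divr_gt0 ?mw_weight_gt0 ?mulr_gt0.
Qed.

Lemma g_lt : g eps rho < rho.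
Proof.
rewrite gE ltr_pdivrMr ?mw_weight_gt0 //.
move/andP: rho01 eps01 => [r0 r1] /andP[e0 e1].
rewrite ltr_pM2l // -subr_gt0.
have -> : rho * eps + (1 - rho) - eps = (1 - rho) * (1 - eps) by ring.
by rewrite mulr_gt0 ?subr_gt0.
Qed.

Lemma g_neq_start : ((g eps rho, 1 - g eps rho) == (rho, 1 - rho)) = false.
Proof. by rewrite xpair_eqE (lt_eqF g_lt). Qed.

(** In either state the next one depends only on expert 2. At [rho], if both experts err, the factor
    [eps] cancels and the weight stays; at [g eps rho], an error of expert 2 alone undoes the
    earlier lie. *)
Lemma hist_toggle (y x2 : nat -> bool) (t : nat) :
  (hist eps rho (toggle rho) y x2 t).2 =
  if at_start y x2 t then (rho, 1 - rho) else (g eps rho, 1 - g eps rho).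
Proof.
have d0 := lt0r_neq0 mw_weight_gt0.
have e0 : eps != 0 by case/andP: eps01 => /lt0r_neq0.
(* [d1] is the normalizer when both experts err; [d2] is the one for a truth from [g eps rho] with
   expert 2 wrong, after clearing the denominator of [gE]. *)
have d1 : rho * eps + (1 - rho) * eps != 0.
  by rewrite -mulrDl (addrC rho) subrK mul1r.
have d2 : rho * eps + (rho * eps + (1 - rho) - rho * eps) * eps != 0.
  by rewrite (addrC (rho * eps) (1 - rho)) addrK.
elim: t => [//|t IH] /=; rewrite IH /toggle IH.
case: (at_start y x2 t); rewrite ?eqxx ?g_neq_start /mw_update /=;
  case: (y t) (x2 t) => [] []; rewrite /= ?expr0 ?expr1 ?gE //.
all: by congr (_, _); field; rewrite ?d0 ?d1 ?d2.
Qed.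

(** The fourth case, a truth with expert 2 correct, costs nothing. *)
Lemma loss_toggle (y x2 : nat -> bool) (t : nat) :
  loss eps rho (toggle rho) y x2 t =
  rho * (at_start y x2 t && (x2 t == y t))%:R +
  (at_start y x2 t && (x2 t != y t))%:R +
  (1 - g eps rho) * ((x2 t != y t) && ~~ at_start y x2 t)%:R.
Proof.
case/andP: rho01 => r0 r1.
have g1 := lt_trans g_lt r1.
rewrite /loss /forecast /toggle hist_toggle.
case: (at_start y x2 t); rewrite ?eqxx ?g_neq_start /=;
  case: (y t) (x2 t) => [] [] /=;
  rewrite ?(mulr1, mulr0, addr0, add0r, subr0).
all: rewrite ?(addrC (1 - _)) ?(addrC _ (1 - _)) ?subrK ?subrr ?sub0r
  ?normrN ?normr0 ?normr1 //.
all: by rewrite ?(@gtr0_norm _ rho) ?(@gtr0_norm _ (1 - _)) ?(@ltr0_norm _ (_ - 1)); lra.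
Qed.

(** * Probabilities of the events that carry a loss *)

Section Random.
Context d (T : measurableType d) (P : probability T R).
Context (y x2 : nat -> {RV P >-> bool}) (mu : R).
Context (mu01 : 0 < mu < 1) (x2_honest : honest eps rho y x2 mu).

Definition correct t := [set w | x2 t w = y t w].
Definition started t := [set w | at_start (y^~ w) (x2^~ w) t].

Lemma measurable_correct t : measurable (correct t).
Proof.
have -> : correct t = (x2 t @^-1` [set true] `&` y t @^-1` [set true]) `|`
                (x2 t @^-1` [set false] `&` y t @^-1` [set false]).
  apply/seteqP; split => w; rewrite /correct /=.
    by move=> ->; case: (y t w); [left|right].
  by move=> [[-> ->]|[-> ->]].
by apply: measurableU; apply: measurableI; apply: measurable_funPTI.
Qed.

Lemma at_startS t : started t.+1 = ~` correct t.
Proof. by apply/seteqP; split => w /eqP. Qed.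

Lemma measurable_at_start t : measurable (started t).
Proof.
case: t => [|t]; last by rewrite at_startS; apply/measurableC/measurable_correct.
by rewrite (_ : started 0 = setT) //; apply/seteqP; split.
Qed.

Lemma prob_correct t : P (correct t) = mu%:E.
Proof.
have := x2_honest (toggle rho) t setT.
have -> : [set w | setT (hist eps rho (toggle rho) (y^~ w) (x2^~ w) t) /\
             x2 t w = y t w] = correct t by apply/seteqP; split => w // [].
by rewrite [X in (P X * _)%E](_ : _ = setT) ?probability_setT ?mul1e.
Qed.

Definition start_prob (t : nat) : R := if t is 0 then 1 else 1 - mu.

Lemma prob_start t : P (started t) = (start_prob t)%:E.
Proof.
case: t => [|t].
  by rewrite (_ : started 0 = setT) ?probability_setT //; apply/seteqP; split.
by rewrite at_startS probability_setC ?prob_correct //; exact: measurable_correct.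
Qed.

(** Under [toggle], [started t] says that the current weights are [(rho, 1 - rho)], an event of the
    history, so honesty makes it independent of [correct t]. *)
Lemma prob_start_correct t : P (started t `&` correct t) = (P (started t) * mu%:E)%E.
Proof.
have start w : (hist eps rho (toggle rho) (y^~ w) (x2^~ w) t).2 = (rho, 1 - rho) <->
    started t w.
  rewrite hist_toggle /started /=; case: ifP => // _; split=> // -[/eqP].
  by rewrite (lt_eqF g_lt).
have := x2_honest (toggle rho) t [set h | h.2 = (rho, 1 - rho)].
rewrite [X in (P X * _)%E](_ : _ = started t); last by apply/seteqP; split => w /start.
by move=> <-; congr (P _); apply/seteqP; split => w [/start].
Qed.

Lemma prob_setD (A B : set T) : measurable A -> measurable B ->
  P (A `\` B) = (P A - P (A `&` B))%E.
Proof.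
move=> mA mB; apply: measureD => //.
exact: le_lt_trans (probability_le1 P mA) (ltry 1).
Qed.

Lemma prob_start_incorrect t :
  P (started t `\` correct t) = (start_prob t - start_prob t * mu)%:E.
Proof.
rewrite prob_setD; [|exact: measurable_at_start|exact: measurable_correct].
by rewrite prob_start_correct prob_start -EFinM -EFinD.
Qed.

Lemma prob_incorrect_nonstart t :
  P (~` correct t `\` started t) =
  (1 - mu - (start_prob t - start_prob t * mu))%:E.
Proof.
have mC := measurable_correct t; have mA := measurable_at_start t.
rewrite prob_setD //; last exact: measurableC.
rewrite (setIC (~` _)) -setDE prob_start_incorrect.
by rewrite probability_setC // prob_correct -!EFinD.
Qed.

(** * Expected loss of one round *)

Definition mean_loss t : R :=
  let q := start_prob t in
  rho * (q * mu) + (q - q * mu) + (1 - g eps rho) * ((1 - mu) - (q - q * mu)).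

(** A nonnegative combination of indicators of measurable events gives both the measurability of the
    loss and its integral. *)
Lemma loss_indicE t w :
  (loss eps rho (toggle rho) (y^~ w) (x2^~ w) t)%:E =
  (rho%:E * (\1_(started t `&` correct t) w)%:E +
   (\1_(started t `\` correct t) w)%:E +
   (1 - g eps rho)%:E * (\1_(~` correct t `\` started t) w)%:E)%E.
Proof.
have ind (S : set T) (b : bool) : (S w <-> b) -> \1_S w = b%:R :> R.
  by move=> h; rewrite indicE (_ : (w \in S) = b) //; apply/idP/idP; rewrite inE => /h.
rewrite (ind _ (at_start (y^~ w) (x2^~ w) t && (x2 t w == y t w))); last first.
  by split=> [[-> /eqP]|/andP[? /eqP]].
rewrite (ind _ (at_start (y^~ w) (x2^~ w) t && (x2 t w != y t w))); last first.
  by split=> [[-> /eqP]|/andP[? /eqP]].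
rewrite (ind _ ((x2 t w != y t w) && ~~ at_start (y^~ w) (x2^~ w) t)); last first.
  by split=> [[/eqP -> /negP]|/andP[/eqP ? /negP]].
by rewrite loss_toggle !EFinD !EFinM.
Qed.

Lemma measurable_loss_toggle t :
  measurable_fun [set: T] (fun w =>
    (loss eps rho (toggle rho) (y^~ w) (x2^~ w) t)%:E).
Proof.
have mA := measurable_at_start t; have mC := measurable_correct t.
under eq_fun do rewrite loss_indicE.
have mi (S : set T) : measurable S -> measurable_fun [set: T] (fun w => (\1_S w : R)%:E).
  by move=> mS; apply/measurable_EFinP; exact: measurable_indic.
apply: emeasurable_funD; first apply: emeasurable_funD.
- by apply: measurable_funeM; apply: mi; exact: measurableI.
- by apply: mi; exact: measurableD.
- by apply: measurable_funeM; apply: mi; apply: measurableD => //; exact: measurableC.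
Qed.

Lemma expectation_loss_toggle t :
  (\int[P]_w (loss eps rho (toggle rho) (y^~ w) (x2^~ w) t)%:E)%E = (mean_loss t)%:E.
Proof.
have mA := measurable_at_start t; have mC := measurable_correct t.
have mAC : measurable (started t `&` correct t) by exact: measurableI.
have mAD : measurable (started t `\` correct t) by exact: measurableD.
have mDA : measurable (~` correct t `\` started t).
  by apply: measurableD => //; exact: measurableC.
under eq_integral do rewrite loss_indicE.
have r0 : 0 <= rho by case/andP: rho01 => /ltW.
have g1 : 0 <= 1 - g eps rho.
  by case/andP: rho01 => _ r1; rewrite subr_ge0 ltW // (lt_trans g_lt).
have i0 (S : set T) w : (0 <= (\1_S w)%:E :> \bar R)%E by rewrite lee_fin.
have mi (S : set T) : measurable S ->
    measurable_fun [set: T] (fun w => (\1_S w : R)%:E).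
  by move=> mS; apply/measurable_EFinP; exact: measurable_indic.
have mki (S : set T) (k : R) : measurable S ->
    measurable_fun [set: T] (fun w => k%:E * (\1_S w : R)%:E)%E.
  by move=> mS; apply: emeasurable_funM; [exact: measurable_cst|exact: mi].
have ki0 (S : set T) (k : R) w : 0 <= k -> (0 <= k%:E * (\1_S w)%:E :> \bar R)%E.
  by move=> k0; rewrite mule_ge0 ?lee_fin.
rewrite ge0_integralD //; [|by move=> w _; rewrite adde_ge0 ?ki0 ?i0
  |by apply: emeasurable_funD; [exact: mki|exact: mi]|by move=> w _; exact: ki0
  |exact: mki].
rewrite ge0_integralD //; [|by move=> w _; exact: ki0|exact: mki|exact: mi].
rewrite !ge0_integralZl_EFin //; [|exact: mi|exact: mi].
have intE (S : set T) : measurable S -> (\int[P]_w (\1_S w)%:E = P S)%E.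
  by move=> mS; rewrite integral_indic // setIT.
rewrite !intE //.
rewrite prob_start_correct prob_start_incorrect prob_incorrect_nonstart prob_start.
by rewrite -!EFinM -!EFinD.
Qed.

Lemma mean_loss_ge t :
  1 - mu + mu * (1 - mu) * (rho - g eps rho) <= mean_loss t.
Proof.
case/andP: mu01 => m0 m1; case/andP: rho01 => r0 r1; have g0 := g_gt0.
rewrite /mean_loss; case: t => [|t] /=.
  rewrite -subr_ge0.
  (* The surplus of the first round, where [start_prob] is 1. *)
  have -> : rho * (1 * mu) + (1 - 1 * mu) +
     (1 - g eps rho) * (1 - mu - (1 - 1 * mu)) -
     (1 - mu + mu * (1 - mu) * (rho - g eps rho)) =
     mu * (mu * rho + (1 - mu) * g eps rho) by ring.
  by rewrite ltW // mulr_gt0 // addr_gt0 // mulr_gt0 // subr_gt0.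
(* In later rounds [start_prob] is [1 - mu] and the bound is an equality. *)
by rewrite le_eqVlt; apply/orP; left; apply/eqP; ring.
Qed.

(** * From one round to the value and its limit inferior *)

Lemma value_ge N :
  ((N%:R * (1 - mu + mu * (1 - mu) * (rho - g eps rho)))%:E <=
    value eps rho y x2 N)%E.
Proof.
apply: (@le_trans _ _ (expected_loss eps rho y x2 (toggle rho) N)); last first.
  by apply: ereal_sup_ubound; exists (toggle rho).
rewrite /expected_loss unlock.
under eq_integral do rewrite -sumEFin.
rewrite ge0_integral_sum //; last 2 first.
- by move=> t; exact: measurable_loss_toggle.
- by move=> t w _; rewrite lee_fin normr_ge0.
under eq_bigr do rewrite expectation_loss_toggle.
(* The bound times [N] becomes a sum of [N] equal terms, to be compared round by round. *)
rewrite sumEFin lee_fin mulr_natl -[X in _ *+ X]card_ord -sumr_const.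
by apply: ler_sum => t _; exact: mean_loss_ge.
Qed.

End Random.
End Toggle.

Theorem mainTheorem2 (R : realType) (mu eps rho : R)
  (mu01 : 0 < mu < 1) (eps01 : 0 < eps < 1) (rho01 : 0 < rho < 1)
  (d : measure_display) (T : measurableType d) (P : probability T R)
  (y x2 : nat -> {RV P >-> bool}) (x2_honest : honest eps rho y x2 mu) :
  ((1 - mu + mu * (1 - mu) * (rho - g eps rho))%:E <=
     limn_einf (fun N : nat => value eps rho y x2 N * (N%:R^-1)%:E))%E /\
  1 - mu < 1 - mu + mu * (1 - mu) * (rho - g eps rho).
Proof.
split; last first.
  case/andP: mu01 => m0 m1.
  by rewrite ltrDl !mulr_gt0 ?subr_gt0 // g_lt.
(* The limit inferior is the limit of the tail infima, so it suffices to bound every term of a tail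
   with [n > 0]. This excludes [N = 0], where the quotient is 0 by the convention for the inverse of
   0. *)
rewrite limn_einf_lim; apply: lime_ge; first exact: is_cvg_einfs.
near=> n; apply: le_ereal_inf_tmp => _ [N /= nN <-].
have N0 : 0 < N%:R :> R.
  by rewrite ltr0n; apply: leq_trans nN; near: n; exact: nbhs_infty_gt.
rewrite lee_pdivlMr // -EFinM mulrC; exact: value_ge.
Unshelve. all: by end_near.
Qed.
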